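(* Let $\xi,\xi_1,\xi_2,\ldots$ be independent identically distributed real random variables with ${\bf E}|\xi|<\infty$ and common distribution $F$, and let $\tau$ be a counting random variable with ${\bf E}\tau<\infty$ that does not depend on the future of the sequence $\{\xi_n\}$. Assume that $F\in\mathcal S^*$ and that there exists an increasing function $h(x)$ such that $$ \overline F(x\pm h(x))\sim\overline F(x)\quad\text{and}\quad{\bf P}\{\tau>h(x)\}=o(\overline F(x))\quad\text{as }x\to\infty . $$ Then ${\bf P}\{S_\tau>x\}\sim{\bf E}\tau\,\overline F(x)$ as $x\to\infty$, that is, ${\bf P}\{S_\tau>x\}/\overline F(x)\to{\bf E}\tau$.
   Context: $\overline F(x)={\bf P}\{\xi>x\}$, and $F$ is right-unbounded: $\overline F(x)>0$ for all $x$. $S_0=0$, $S_n=\xi_1+\cdots+\xi_n$. A counting random variable is a random variable with values in $\{0,1,2,\ldots\}$; $S_\tau$ is $S_n$ evaluated at the random index $n=\tau$. The notation $\overline F(x\pm h(x))\sim\overline F(x)$ means that both $\overline F(x+h(x))/\overline F(x)\to1$ and $\overline F(x-h(x))/\overline F(x)\to1$. A distribution $F$ on ${\bf R}$ with finite mean (and $\overline F(x)>0$ for all $x$) belongs to the class $\mathcal S^*$ if $\int_0^x\overline F(x-y)\overline F(y)\,dy\sim 2a\,\overline F(x)$ as $x\to\infty$, where $a=\int_0^\infty\overline F(y)\,dy$. A counting random variable $\tau$ does not depend on the future of the sequence $\{\xi_n\}$ if, for every $n\ge0$, the family $(\xi_1,\ldots,\xi_n,{\bf I}\{\tau\le n\})$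 is independent of the family $(\xi_j,\ j\ge n+1)$ (for $n=0$ this says that ${\bf I}\{\tau\le0\}$ is independent of $(\xi_j,\ j\ge1)$). *)

(* Defs.v *)
From mathcomp Require Import all_boot all_order all_algebra finmap.
From mathcomp Require Import all_classical all_reals all_analysis.

Set Implicit Arguments.
Unset Strict Implicit.
Unset Printing Implicit Defensive.

Import Order.TTheory GRing.Theory Num.Theory.
Import numFieldNormedType.Exports.

Local Open Scope classical_set_scope.
Local Open Scope ring_scope.

Canonical pinfty_filter_on (R : realType) :=
  FilterType (pinfty_nbhs R) (@filter_filter _ _ (@proper_pinfty_nbhs R)).

(* f ~ g at +oo, used for functions g that do not vanish. *)
Definition asymp_eq (R : realType) (f g : R -> R) : Prop :=
  f x / g x @[x --> +oo] --> (1 : R).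

Definition tail (R : realType) (F : probability R R) (x : R) : R :=
  fine (F `]x, +oo[%classic).

(* The class S^*; under the first two conjuncts both integrals are finite and
   the right-hand side of the equivalence is positive. *)
Definition in_Sstar (R : realType) (F : probability R R) : Prop :=
  let a := \int[lebesgue_measure]_(y in `[0, +oo[) tail F y in
  [/\ F.-integrable setT (fun x : R => x%:E),
      forall x, 0 < tail F x
    & asymp_eq
        (fun x => \int[lebesgue_measure]_(y in `[0, x]) (tail F (x - y) * tail F y))
        (fun x => 2 * a * tail F x)].

Section families.
Context d (T : measurableType d) (R : realType) (P : probability T R).

(* In a sequence X : nat -> {RV P >-> R} the entry X i stands for the
   (i+1)-st variable, so that X 0, ..., X n.-1 are the first n ones. *)

Definition mutually_independent (X : nat -> {RV P >-> R}) : Prop :=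
  forall (J : {fset nat}) (B : nat -> set R),
    (forall i, i \in J -> measurable (B i)) ->
    P (\bigcap_(i in [set` J]) (X i @^-1` B i)) =
    (\prod_(i <- J) P (X i @^-1` B i))%E.

Definition iid_copies (X : {RV P >-> R}) (X_ : nat -> {RV P >-> R}) : Prop :=
  mutually_independent X_ /\
  forall i (B : set R), measurable B ->
    distribution P (X_ i) B = distribution P X B.

Definition past (X : nat -> {RV P >-> R}) (tau : {RV P >-> nat}) (n : nat) :
    set_system T :=
  <<s (\bigcup_(i in [set i | (i < n)%N])
          preimage_set_system setT (X i) measurable)
      `|` preimage_set_system setT
            (\1_[set w | (tau w <= n)%N] : T -> R) measurable >>.

Definition future (X : nat -> {RV P >-> R}) (n : nat) : set_system T :=
  <<s \bigcup_(i in [set i | (n <= i)%N])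
        preimage_set_system setT (X i) measurable >>.

Definition independent_of_future (X : nat -> {RV P >-> R})
    (tau : {RV P >-> nat}) : Prop :=
  forall n A B, past X tau n A -> future X n B ->
    P (A `&` B) = (P A * P B)%E.

Definition random_sum (X : nat -> {RV P >-> R}) (tau : {RV P >-> nat})
    (w : T) : R :=
  \sum_(i < tau w) X i w.

End families.

(* Main.v *)
From HB Require Import structures.
Require Import Defs.
From mathcomp Require Import all_boot all_order all_algebra finmap.
From mathcomp Require Import all_classical all_reals all_analysis.
From mathcomp Require Import measurable_realfun zify ring lra.

Set Implicit Arguments.
Unset Strict Implicit.
Unset Printing Implicit Defensive.

Import Order.TTheory GRing.Theory Num.Theory.
Import numFieldNormedType.Exports.

Local Open Scope classical_set_scope.
Local Open Scope ring_scope.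

(** Write G for the tail of the common law, E tau for the mean of tau.  The
theorem is an instance of the principle of one big jump: for large x the event
S_tau > x occurs essentially because one summand with index at most tau exceeds
x on its own, the other summands contributing a multiple of h(x), a shift to
which G is insensitive.  As the event n < tau is independent of the (n+1)-st
summand, the expected number of such large summands is E tau * G(x).

For the upper bound, fix a large integer k and let y be obtained from x by
applying k times the map z |-> z - h(z).  Then G(y) ~ G(x), the event
tau > h(y) has probability o(G(x)), and when tau <= h(y) the event S_tau > x
forces the walk with steps xi_i - k, stopped at tau, to exceed
x - k h(y) >= y.  It remains to bound the probability of this last event by
(1 + o(1)) E tau * G(y), and here the freedom of choosing k large is decisive:
the drift -k dominates every constant in sight.  For a level x to be crossed,
with s = x - position, the function
  1{s < 0} + c * (sum of G(j) over the integers s < j <= x)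
is a Lyapunov function of the walk.  In one step its mean increases by at most
(1 + e)^2 G(x), wherever the walk is (lyapunov_drift): a jump above the level
costs G(s); a smaller upward jump is paid for by the convolution of G with
itself, which the class S^* bounds by a multiple of G(s); and the downward
drift wins back an arbitrarily large multiple of c * G(s).  Only close to the
origin, where the sum has been cut off and a step down wins nothing, does an
increase remain.  Summing over the steps made before tau (stopped_walk_expectation)
gives the bound, since the function vanishes at the origin and is at least 1
above x.

For the lower bound, random_sum_lower adds up the probabilities of disjoint
events on which one big jump occurs, the earlier summands being bounded and
the m = floor(h(x)) later ones adding up to at most k m in absolute value.
Markov's inequality makes the last requirement harmless for k large, so that no
law of large numbers is involved. *)

Lemma indic_pred (T : Type) (R : pzRingType) (b : pred T) w :
  \1_[set w | b w] w = (b w)%:R :> R.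
Proof.
rewrite indicE; case bw: (b w); first by rewrite mem_set.
by rewrite memNset//= bw.
Qed.

(** * A Lyapunov function for walks with a heavy right tail *)

Section lyapunov.
Context {R : realType} (G : R -> R).
Hypothesis G_antitone : forall x y, x <= y -> G y <= G x.
Hypothesis G_gt0 : forall x, 0 < G x.
Let G_ge0 x : 0 <= G x. Proof. exact/ltW. Qed.
Hypothesis G_le1 : forall x, G x <= 1.

(** The argument is the distance s from the current position up to the level to
be crossed; it is negative once the level has been passed.  The sum is a
discrete form of the integrated tail, cut off at n so that the function
vanishes at and below the origin when n is at most the level. *)
Definition lyapunov (d : R) (n : nat) (s : R) : R :=
  (s < 0)%R%:R + d * \sum_(1 <= j < n.+1) G j%:R * (s < j%:R)%R%:R.

(** The mean of the Lyapunov function after one step distributed as xi - k, when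
G is the tail of xi. *)
Definition lyapunov_step (d : R) (n k : nat) (s : R) : R :=
  G (s + k%:R) + d * \sum_(1 <= j < n.+1) G j%:R * G (s - j%:R + k%:R).

Lemma lyapunov_ge0 d n s : 0 <= d -> 0 <= lyapunov d n s.
Proof.
move=> d0; rewrite addr_ge0// mulr_ge0// sumr_ge0// => j _.
by rewrite mulr_ge0// ltW.
Qed.

Lemma lyapunov_beyond d n s : n%:R <= s -> lyapunov d n s = 0.
Proof.
move=> ns; rewrite /lyapunov ltNge (le_trans _ ns)//= add0r big_nat big1 ?mulr0//.
move=> j /andP[_ jn]; rewrite ltNge (le_trans _ ns) ?mulr0// ler_nat.
by rewrite -ltnS.
Qed.

Lemma lyapunov_step_antitone d n k s t : 0 <= d -> s <= t ->
  lyapunov_step d n k t <= lyapunov_step d n k s.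
Proof.
move=> d0 st; rewrite lerD ?G_antitone ?lerD2r// ler_wpM2l// ler_sum// => j _.
by rewrite ler_wpM2l ?G_ge0 // G_antitone// !lerD2r.
Qed.

(** The summation index p = floor(s) + 1 is the least integer above s, so that the
indicators select exactly the terms from p on. *)
Lemma lyapunov_split d n s : 0 <= s -> ((Num.truncn s).+1 <= n.+1)%N ->
  lyapunov d n s = d * \sum_((Num.truncn s).+1 <= j < n.+1) G j%:R.
Proof.
move=> s0 pn; rewrite /lyapunov ltNge s0 add0r; congr (d * _).
rewrite (big_cat_nat (n := (Num.truncn s).+1))//= big_nat big1 ?add0r; last first.
  move=> j /andP[_ jp]; rewrite ltNge (le_trans (y := (Num.truncn s)%:R)) ?mulr0//.
    by rewrite ler_nat -ltnS.
  by rewrite truncn_le.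
apply: eq_big_nat => j /andP[pj _]; rewrite (lt_le_trans (truncnS_gt s)) ?mulr1//.
by rewrite ler_nat.
Qed.

(** The order of the choices matters: first the weight d, so small that the
convolution term d * C * G(s) is at most e * G(s); then K, such that winning the
K terms of the sum next to s with probability at least 1/2 outweighs
(1 + d * C) * G(s); then A, beyond which the convolution bound and
G(s) <= 2 * G(s + K + 1) hold; and last the drift k, which makes those K terms
be won with probability 1/2 and, for the remaining s <= A, makes all
upward contributions, of order G(k), as small as necessary.  As C, K and A do
not depend on k, there is no circularity. *)
Lemma lyapunov_drift (C e : R) : 0 <= C -> 0 < e ->
  G x @[x --> +oo] --> 0 ->
  (forall c u : R, 0 < u -> \forall x \near +oo, G (x - c) <= (1 + u) * G x) ->
  (\forall s \near +oo, \sum_(1 <= j < (Num.truncn s).+1)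
      G j%:R * G (s - j%:R + 1) <= C * G s) ->
  exists k : nat, exists2 d : R, 0 <= d &
    \forall x \near +oo, forall s,
      lyapunov_step d (Num.truncn x) k s <=
      lyapunov d (Num.truncn x) s + (1 + e) ^+ 2 * G x.
Proof.
move=> C0 e0 G0 Glong [A1 [_ GC]].
have smallG u : 0 < u -> \forall x \near +oo, G x <= u.
  move=> u0; have /cvgrPdist_le/(_ _ u0) := G0; apply: filterS => x.
  by rewrite sub0r normrN (gtr0_norm (G_gt0 _)).
set d := e / (C + 1).
have d0 : 0 < d by rewrite divr_gt0//; lra.
have dC : d * C <= e.
  by rewrite /d mulrAC ler_pdivrMr ?ler_wpM2l ?G_ge0 ?(ltW d0)//; lra.
set K := (Num.truncn (4 * (1 + d * C) / d)).+1.
have dK : 4 * (1 + d * C) <= d * K%:R.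
  by rewrite [leRHS]mulrC -ler_pdivrMr//; exact/ltW/truncnS_gt.
have dK0 : 0 <= d * K%:R by apply: mulr_ge0; [exact: ltW|exact: ler0n].
have [A2 [_ GK]] := Glong (K%:R + 1) 1 ltr01.
set A := Num.max 0 (Num.max A1 A2).
have AGC s : A < s -> \sum_(1 <= j < (Num.truncn s).+1)
      G j%:R * G (s - j%:R + 1) <= C * G s.
  by rewrite !gt_max => /and3P[_ sA _]; exact: GC.
have AGK s : A < s -> G s <= 2 * G (s + (K%:R + 1)).
  rewrite !gt_max => /and3P[_ _ sA].
  have /GK : A2 < s + (K%:R + 1) by rewrite (lt_le_trans sA)// lerDl addr_ge0.
  by rewrite addrK; lra.
set B := (Num.truncn A)%:R : R.
have B0 : 0 <= B by [].
set u := d * K%:R * G (A + (K%:R + 1)) / 2 / (1 + d * B).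
have dB : 0 < 1 + d * B by rewrite ltr_wpDr// mulr_ge0// ltW.
have u0 : 0 < u by rewrite divr_gt0// divr_gt0// mulr_gt0// mulr_gt0.
have [a1 [_ Ga1]] := smallG _ u0.
have [a2 [_ Ga2]] : \forall x \near +oo, G x <= 2^-1 by apply: smallG; lra.
set k := (Num.truncn (Num.max 0 (Num.max a1 (a2 + K%:R)))).+1.
have ka : Num.max 0 (Num.max a1 (a2 + K%:R)) < k%:R by exact: truncnS_gt.
move: ka; rewrite !gt_max => /and3P[_ /Ga1 Gk ka2].
have {ka2} GkK : G (k%:R - K%:R) <= 2^-1 by apply: Ga2; lra.
exists k; exists d; first exact: ltW.
have k1 : 1 <= k%:R :> R by rewrite ler1n.
near=> x.
have x0 : 0 <= x by near: x; apply: nbhs_pinfty_ge; rewrite num_real.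
have xAK : A + K%:R < x by near: x; apply: nbhs_pinfty_gt; rewrite num_real.
have GxK : G (x - K%:R) <= (1 + e) * G x by near: x; exact: Glong.
set n := Num.truncn x.
have nx : n%:R <= x by rewrite truncn_le.
have xn : x < n.+1%:R by exact: truncnS_gt.
have Gx0 : 0 <= (1 + e) ^+ 2 * G x.
  by rewrite mulr_ge0 ?G_ge0// exprn_ge0//; lra.
have convk s : 0 <= s -> \sum_(1 <= j < (Num.truncn s).+1) G j%:R * G (s - j%:R + k%:R)
    <= \sum_(1 <= j < (Num.truncn s).+1) G j%:R * G (s - j%:R + 1).
  move=> s0; apply: ler_sum => j _; rewrite ler_wpM2l ?G_ge0 ?(ltW d0)//.
  by rewrite G_antitone// lerD2l.
(* for indices above s, the terms of the step sum are dominated by those of the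
   function itself *)
have above (p q : nat) s : \sum_(p <= j < q) G j%:R * G (s - j%:R + k%:R)
    <= \sum_(p <= j < q) G j%:R.
  by apply: ler_sum => j _; rewrite ler_piMr// ltW.
(* near the origin, where the cutoff suppresses the gain from moving down, the
   increase is that of a single jump and of the convolution *)
have edge s : 0 <= s -> x - K%:R <= s -> s <= x ->
    lyapunov_step d n k s <= lyapunov d n s + (1 + e) ^+ 2 * G x.
  move=> s0 xs sx.
  have pn : ((Num.truncn s).+1 <= n.+1)%N by rewrite ltnS le_truncn.
  have As : A < s by lra.
  rewrite lyapunov_split// /lyapunov_step (big_cat_nat (n := (Num.truncn s).+1))//=.
  have h1 := AGC s As.
  have h2 := convk s s0.
  have h3 := above (Num.truncn s).+1 n.+1 s.
  have h4 : G (s + k%:R) <= G s by rewrite G_antitone// lerDl.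
  have h5 : G s <= (1 + e) * G x by rewrite (le_trans _ GxK)// G_antitone.
  set S1 := bigop _ _ _ in h2 *; set S2 := bigop _ _ _ in h3 *.
  set S3 := bigop _ _ _ in h3 *.
  have h6 : d * S1 <= d * C * G s by rewrite -mulrA ler_wpM2l ?G_ge0 ?(ltW d0)// (le_trans h2).
  have h7 : d * S2 <= d * S3 by rewrite ler_wpM2l ?(ltW d0) ?G_ge0.
  have h8 : d * C * G s <= e * G s by rewrite ler_wpM2r ?(ltW d0) ?G_ge0.
  have h9 : (1 + e) * G s <= (1 + e) ^+ 2 * G x.
    by rewrite expr2 -mulrA ler_wpM2l//; lra.
  by rewrite mulrDr; lra.
move=> s; have [s0|s0] := ltP s 0.
  rewrite -[leLHS]addr0 lerD// /lyapunov_step /lyapunov s0 lerD// ler_wpM2l ?G_ge0 ?(ltW d0)//.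
  apply: ler_sum_nat => j /andP[j1 _]; rewrite ler_wpM2l ?G_ge0 ?(ltW d0)//.
  by rewrite (lt_le_trans s0)// ler0n.
(* below the origin the function vanishes, and the step sum is smaller than at
   the origin itself *)
have [sx|xs] := ltP x s.
  apply: (le_trans (lyapunov_step_antitone n k (ltW d0) (ltW sx))).
  apply: (le_trans (edge x x0 _ (lexx x))); first by rewrite gerBl.
  by rewrite lyapunov_beyond// add0r lerDr lyapunov_ge0// ltW.
have [xKs|sxK] := leP (x - K%:R) s; first exact: edge.
rewrite -[leLHS]addr0 lerD//.
set p := (Num.truncn s).+1.
have sp : s < p%:R by exact: truncnS_gt.
have ps : p%:R <= s + 1 by rewrite /p -natr1 lerD2r truncn_le.
have pK : (p + K <= n.+1)%N.
  have : (p + K)%:R < n.+2%:R :> R by rewrite natrD -(@natr1 R n.+1); lra.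
  by rewrite ltr_nat ltnS.
have pn : (p <= n.+1)%N by rewrite (leq_trans _ pK)// leq_addr.
rewrite lyapunov_split// /lyapunov_step (big_cat_nat (n := p))//=.
rewrite -/p (big_cat_nat (n := p + K) (m := p) (p := n.+1))//= ?leq_addr//.
rewrite [X in _ <= _ * X](big_cat_nat (n := p + K))//= ?leq_addr//.
have h1 := above (p + K)%N n.+1 s.
(* the gain from the drift, on the K terms next to s *)
have h2 : \sum_(p <= j < p + K) G j%:R * G (s - j%:R + k%:R) <=
    \sum_(p <= j < p + K) G j%:R - K%:R * (G (s + (K%:R + 1)) / 2).
  have -> : K%:R * (G (s + (K%:R + 1)) / 2) =
      \sum_(p <= j < p + K) (G (s + (K%:R + 1)) / 2).
    by rewrite sumr_const_nat addKn mulr_natl.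
  rewrite -sumrB; apply: ler_sum_nat => j /andP[pj jpK].
  have jK : j%:R + 1 <= p%:R + K%:R :> R by rewrite natr1 -natrD ler_nat.
  have Gj : G (s + (K%:R + 1)) <= G j%:R by apply: G_antitone; lra.
  have Gs : G (s - j%:R + k%:R) <= 2^-1.
    by rewrite (le_trans _ GkK)// G_antitone//; lra.
  have : G j%:R * G (s - j%:R + k%:R) <= G j%:R * 2^-1 by rewrite ler_wpM2l ?(ltW d0) ?G_ge0.
  by lra.
set S1 := bigop _ _ _; set S2 := bigop _ _ _ in h2 *; set S3 := bigop _ _ _ in h1 *.
set S4 := bigop _ _ _ in h2 *; set S5 := bigop _ _ _ in h1 *.
suff : G (s + k%:R) + d * S1 <= d * K%:R * (G (s + (K%:R + 1)) / 2).
  have : d * (S2 + S3) <= d * (S4 - K%:R * (G (s + (K%:R + 1)) / 2) + S5).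
    by rewrite ler_wpM2l ?G_ge0 ?(ltW d0)// lerD.
  by rewrite !mulrDr !mulrN !mulrA; lra.
have [sA|As] := leP s A.
  have S1B : S1 <= B * G k%:R.
    have -> : B * G k%:R = \sum_(1 <= j < (Num.truncn A).+1) G k%:R.
      by rewrite sumr_const_nat subn1/= mulr_natl.
    rewrite [leRHS](big_cat_nat (n := p))//=; last by rewrite ltnS le_truncn.
    rewrite -[leLHS]addr0 lerD//; last by apply: sumr_ge0 => j _; exact/ltW.
    apply: ler_sum_nat => j /andP[_ jp].
    rewrite -[leRHS]mul1r ler_pM ?G_ge0 ?(ltW d0)// G_antitone// lerDr subr_ge0.
    by rewrite (le_trans (y := (Num.truncn s)%:R)) ?ler_nat ?truncn_le.
  have h3 : G (s + k%:R) <= G k%:R by rewrite G_antitone// lerDr.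
  have h4 : d * S1 <= d * (B * G k%:R) by rewrite ler_wpM2l ?(ltW d0) ?G_ge0.
  have h5 : G k%:R * (1 + d * B) <= d * K%:R * G (A + (K%:R + 1)) / 2.
    by rewrite -ler_pdivlMr.
  have h6 : d * K%:R * G (A + (K%:R + 1)) <= d * K%:R * G (s + (K%:R + 1)).
    by rewrite (ler_wpM2l dK0)// G_antitone// lerD2r.
  by lra.
have h3 : G (s + k%:R) <= G s by rewrite G_antitone// lerDl.
have h4 : d * S1 <= d * (C * G s).
  by rewrite ler_wpM2l ?G_ge0 ?(ltW d0)// (le_trans (convk s s0))// AGC.
have h5 := AGK s As.
have h6 : 4 * (1 + d * C) * G s <= d * K%:R * G s by rewrite ler_wpM2r// ltW.
have h7 : d * K%:R * G s <= d * K%:R * (2 * G (s + (K%:R + 1))).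
  by rewrite (ler_wpM2l dK0).
by lra.
Unshelve. all: by end_near.
Qed.
End lyapunov.

(** * Shifts to which the tail is insensitive *)

Section asymptotics.
Context {R : realType} (G : R -> R).
Hypothesis G_antitone : forall x y, x <= y -> G y <= G x.
Hypothesis G_gt0 : forall x, 0 < G x.
Hypothesis G_cvg0 : G x @[x --> +oo] --> 0.

Lemma tail_small u : 0 < u -> \forall x \near +oo, G x < u.
Proof.
move=> u0; have /cvgrPdist_lt/(_ _ u0) := G_cvg0; apply: filterS => x.
by rewrite sub0r normrN (gtr0_norm (G_gt0 _)).
Qed.

Lemma asymp_eq_le (f : R -> R) u : asymp_eq (fun x => G (f x)) G -> 0 < u ->
  \forall x \near +oo, G (f x) <= (1 + u) * G x.
Proof.
move=> fG u0; have /cvgrPdist_le/(_ _ u0) := fG; apply: filterS => x.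
by rewrite distrC ler_distl => /andP[_]; rewrite ler_pdivrMr.
Qed.

Lemma asymp_eq_ge (f : R -> R) u : asymp_eq (fun x => G (f x)) G -> 0 < u ->
  \forall x \near +oo, (1 - u) * G x <= G (f x).
Proof.
move=> fG u0; have /cvgrPdist_le/(_ _ u0) := fG; apply: filterS => x.
by rewrite distrC ler_distl => /andP[+ _]; rewrite ler_pdivlMr.
Qed.

(** G(f(x)) tends to 0 together with G(x), while G is bounded below by a positive
number on each half-line bounded above. *)
Lemma asymp_eq_cvg_pinfty (f : R -> R) :
  asymp_eq (fun x => G (f x)) G -> f x @[x --> +oo] --> +oo.
Proof.
move=> fG; apply/cvgryPgt => M.
have GM : 0 < G M / 2 by rewrite divr_gt0.
near=> x.
have h1 : G (f x) <= (1 + 1) * G x by near: x; exact: asymp_eq_le.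
have h2 : G x < G M / 2 by near: x; exact: tail_small.
by rewrite ltNge; apply/negP => /G_antitone; lra.
Unshelve. all: by end_near.
Qed.

Lemma asymp_eq_refl : asymp_eq G G.
Proof.
rewrite /asymp_eq (_ : (fun x => _) = fun=> 1); first exact: cvg_cst.
by apply/funext => x; rewrite divff// gt_eqF.
Qed.

Lemma asymp_eq_iter (f : R -> R) k : asymp_eq (fun x => G (f x)) G ->
  asymp_eq (fun x => G (iter k f x)) G.
Proof.
move=> fG; elim: k => [|k IH]; first exact: asymp_eq_refl.
rewrite /asymp_eq (_ : (fun x => _) = fun x =>
  G (f (iter k f x)) / G (iter k f x) * (G (iter k f x) / G x)).
  rewrite -[X in _ --> X]mulr1; apply: cvgM; last exact: IH.
  exact: (cvg_comp _ _ (asymp_eq_cvg_pinfty IH) fG).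
by apply/funext => x /=; rewrite mulrA divfK// gt_eqF.
Qed.

Lemma asymp_eq_bounds (f g k : R -> R) :
  asymp_eq f G -> asymp_eq k G ->
  (\forall x \near +oo, f x <= g x <= k x) -> asymp_eq g G.
Proof.
move=> fG kG fgk; apply: (squeeze_cvgr _ fG kG); apply: filterS fgk => x /andP[fg gk].
by rewrite !ler_wpM2r// invr_ge0 ltW.
Qed.

Lemma asymp_eq_long_tailed c u : asymp_eq (fun x => G (x + 1)) G -> 0 < u ->
  \forall x \near +oo, G (x - c) <= (1 + u) * G x.
Proof.
move=> G1 u0; set n := (Num.truncn c).+1.
have cn : c < n%:R by exact: truncnS_gt.
have v0 : 0 < u / (1 + u) by rewrite divr_gt0//; lra.
have [A [_ HA]] := asymp_eq_ge (asymp_eq_iter n G1) v0.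
near=> x.
have : A < x - n%:R by rewrite ltrBrDr; near: x; apply: nbhs_pinfty_gt; rewrite num_real.
move=> /HA.
have -> : 1 - u / (1 + u) = (1 + u)^-1.
  have : 1 + u != 0 by rewrite gt_eqF//; lra.
  by move=> ?; field.
have -> : iter n (+%R^~ 1) (x - n%:R) = x.
  rewrite -[RHS](subrK n%:R); elim: (n) (x - _) => [|m IH] y; first by rewrite addr0.
  by rewrite /= IH -natr1 addrA.
rewrite ler_pdivrMl ?ltr_wpDr//; last exact: ltW.
by apply: le_trans; apply: G_antitone; lra.
Unshelve. all: by end_near.
Qed.

(** As h is nondecreasing, iterating z |-> z + h(z) moves at least as far as
adding h(x) at each iteration. *)
Lemma iter_shift_up (h : R -> R) k x : {homo h : x y / x <= y} ->
  (forall z, 0 <= h z) -> x + k%:R * h x <= iter k (fun z => z + h z) x.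
Proof.
move=> hh h0; elim: k => [|k IH]; first by rewrite mul0r addr0.
rewrite /= -natr1 mulrDl mul1r addrA lerD//.
by apply: hh; rewrite (le_trans _ IH)// lerDl mulr_ge0.
Qed.

(** Downward the shifts decrease along the iteration, so that it is the last value
of h that bounds them from below.  A single value of h at x would not do:
G(x - 2 h(x)) need not be equivalent to G(x). *)
Lemma iter_shift_down (h : R -> R) k x : {homo h : x y / x <= y} ->
  (forall z, 0 <= h z) ->
  let y := iter k (fun z => z - h z) x in y + k%:R * h y <= x.
Proof.
move=> hh h0 /=; elim: k => [|k IH]; first by rewrite mul0r addr0.
rewrite /=; set y := iter k _ x in IH *.
have hy : h (y - h y) <= h y by apply: hh; rewrite gerBl.
apply: le_trans IH; rewrite -natr1 mulrDl mul1r.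
have : k%:R * h (y - h y) <= k%:R * h y by rewrite ler_wpM2l.
by lra.
Qed.
End asymptotics.

(** * The convolution condition in discrete form *)

Section convolution.
Context {R : realType} (G : R -> R).
Hypothesis G_antitone : forall x y, x <= y -> G y <= G x.
Hypothesis G_gt0 : forall x, 0 < G x.
Hypothesis G_le1 : forall x, G x <= 1.

Lemma convolution_integrable (a b s : R) :
  lebesgue_measure.-integrable `[a, b] (EFin \o (fun y => G (s - y) * G y)).
Proof.
have mG : measurable_fun setT G.
  by apply: nonincreasing_measurable => // x y _ _; exact: G_antitone.
apply: measurable_bounded_integrable => //.
- by rewrite /= lebesgue_measure_itv /=; case: ifP => // _; rewrite ltry.
- apply: measurable_funM; last exact: measurable_funTS.
  apply: measurable_funTS; apply: measurableT_comp => //.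
  exact: measurable_funB.
exists 1; split => // u u1 y _ /=; rewrite (le_trans _ (ltW u1))// normrM.
have G_ge0 z : 0 <= G z by exact/ltW.
by rewrite !ger0_norm ?G_ge0// -[leRHS]mulr1 ler_pM.
Qed.

(** On the interval from j - 1 to j the integrand is at least its value with both
factors taken at their smallest. *)
Lemma sum_le_convolution (n : nat) (s : R) : n%:R <= s ->
  \sum_(1 <= j < n.+1) G j%:R * G (s - j%:R + 1) <=
  \int[lebesgue_measure]_(y in `[0, n%:R]) (G (s - y) * G y).
Proof.
elim: n => [_|n IH ns].
  by rewrite big_geq// Rintegral_ge0// => y _; rewrite mulr_ge0// ltW.
rewrite big_nat_recr//= -(subrKC (\int[lebesgue_measure]_(y in `[0, n%:R]) (G (s - y) * G y))
  (\int[lebesgue_measure]_(y in `[0, n.+1%:R]) _)).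
rewrite lerD//; first by rewrite IH// (le_trans _ ns)// ler_nat.
rewrite Rintegral_itvB//; [|exact: convolution_integrable|by rewrite bnd_simp|
  by rewrite bnd_simp ler_nat].
have -> : G n.+1%:R * G (s - n.+1%:R + 1) =
    \int[lebesgue_measure]_(y in `]n%:R, n.+1%:R]) (G n.+1%:R * G (s - n.+1%:R + 1)).
  rewrite Rintegral_cst//= lebesgue_measure_itv /= lte_fin ltr_nat ltnSn.
  by rewrite -EFinB /= (_ : n.+1%:R - n%:R = 1) ?mulr1// -natr1 addrAC subrr add0r.
apply: le_Rintegral => //.
- apply: measurable_bounded_integrable => //.
    by rewrite /= lebesgue_measure_itv /=; case: ifP => // _; rewrite ltry.
  by exists `|G n.+1%:R * G (s - n.+1%:R + 1)|; split => // u /ltW u1 y _.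
- apply: integrableS (convolution_integrable 0 n.+1%:R s) => //.
  by apply: subset_itv; rewrite bnd_simp.
move=> y; rewrite /= in_itv /= => /andP[ny yn].
rewrite [leRHS]mulrC; apply: ler_pM; [exact/ltW|exact/ltW|exact: G_antitone|].
by apply: G_antitone; rewrite -natr1; lra.
Qed.

Lemma convolution_bound_sum :
  let a := \int[lebesgue_measure]_(y in `[0, +oo[) G y in
  asymp_eq (fun x => \int[lebesgue_measure]_(y in `[0, x]) (G (x - y) * G y))
    (fun x => 2 * a * G x) ->
  exists2 C, 0 <= C & \forall s \near +oo,
    \sum_(1 <= j < (Num.truncn s).+1) G j%:R * G (s - j%:R + 1) <= C * G s.
Proof.
move=> a GG; set a2 := 2 * a.
(* if the constant vanished, the quotient by 0 would be 0, not close to 1 *)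
have a20 : 0 < a2.
  rewrite lt_neqAle; apply/andP; split; last first.
    by rewrite mulr_ge0// Rintegral_ge0// => y _; rewrite ltW.
  apply/eqP => a0; have /cvgrPdist_lt/(_ _ ltr01) := GG.
  rewrite -/a2 -a0 => -[M [_ HM]].
  by have := HM (M + 1); rewrite ltrDl ltr01 mul0r invr0 mulr0 subr0 normr1 ltxx => /(_ isT).
exists (2 * a2); first by rewrite mulr_ge0// ltW.
have /cvgrPdist_le/(_ _ ltr01) := GG => GG1; near=> s.
have s0 : 0 <= s by near: s; apply: nbhs_pinfty_ge; rewrite num_real.
have : `|1 - (\int[lebesgue_measure]_(y in `[0, s]) (G (s - y) * G y)) / (a2 * G s)| <= 1.
  by near: s.
rewrite distrC ler_distl => /andP[_]; rewrite (ler_pdivrMr _ _ (mulr_gt0 a20 (G_gt0 s))) => IG.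
have ns : (Num.truncn s)%:R <= s by rewrite truncn_le.
rewrite (le_trans (sum_le_convolution ns))// -mulrA (le_trans _ IG)//.
rewrite -subr_ge0 Rintegral_itvB ?bnd_simp//; last exact: convolution_integrable.
by rewrite Rintegral_ge0// => y _; rewrite mulr_ge0// ltW.
Unshelve. all: by end_near.
Qed.
End convolution.

(** * Independence of the past and the future *)

(** Independence on rectangles makes the joint law of U and Z a product, and
Tonelli's theorem allows the integration over Z to be made first.  The bound g
stands for a conditional expectation given U that need not be computed. *)
Lemma ge0_integral_independent_le d d1 d2 (T : measurableType d)
    (T1 : measurableType d1) (T2 : measurableType d2) (R : realType)
    (P : probability T R) (U : {mfun T >-> T1}) (Z : {mfun T >-> T2})
    (f : T1 * T2 -> \bar R) (g : T1 -> \bar R) :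
  (forall A B, measurable A -> measurable B ->
    P ((U @^-1` A) `&` (Z @^-1` B)) = (P (U @^-1` A) * P (Z @^-1` B))%E) ->
  measurable_fun setT f -> (forall z, (0 <= f z)%E) -> measurable_fun setT g ->
  (forall u, (\int[P]_v f (u, Z v) <= g u)%E) ->
  (\int[P]_w f (U w, Z w) <= \int[P]_w g (U w))%E.
Proof.
move=> indep mf f0 mg fg.
have mUZ : measurable_fun setT (fun w => (U w, Z w)) by exact: measurable_fun_pair.
pose UZ : {mfun T >-> (T1 * T2)%type} := HB.pack (fun w => (U w, Z w))
  (isMeasurableFun.Build _ _ _ _ _ mUZ).
have g0 u : (0 <= g u)%E by apply: le_trans (fg u); exact: integral_ge0.
rewrite -[leLHS](ge0_integral_distribution (P := P) UZ mf f0).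
rewrite -[leRHS](ge0_integral_distribution (P := P) U mg g0).
rewrite (eq_measure_integral (distribution P U \x distribution P Z)%E); last first.
  move=> A mA _; apply/esym; apply: (product_measure_unique (m1 := distribution P U)
    (m2 := distribution P Z) (m' := distribution P UZ)) => //.
rewrite fubini_tonelli1//; apply: ge0_le_integral => //.
- by move=> u _; exact: integral_ge0.
- exact: measurable_fun_fubini_tonelli_F.
move=> u _; rewrite /fubini_F ge0_integral_distribution//.
  exact: fg.
exact: measurableT_comp.
Qed.

Section stopped.
Context d {T : measurableType d} {R : realType} (P : probability T R).
Variables (X : nat -> {RV P >-> R}) (tau : {RV P >-> nat}).
Hypothesis indep : independent_of_future X tau.

Definition past_generator n : set_system T :=
  (\bigcup_(i in [set i | (i < n)%N]) preimage_set_system setT (X i) measurable)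
  `|` preimage_set_system setT (\1_[set w | (tau w <= n)%N] : T -> R) measurable.

Definition future_generator n : set_system T :=
  \bigcup_(i in [set i | (n <= i)%N]) preimage_set_system setT (X i) measurable.

Lemma past_preimage d' (T' : measurableType d') n (g : T -> T') B :
  measurable_fun (setT : set (g_sigma_algebraType (past_generator n))) g -> measurable B ->
  past X tau n (g @^-1` B).
Proof. by move=> mg mB; rewrite -[_ @^-1` _]setTI; exact: mg. Qed.

Lemma future_preimage d' (T' : measurableType d') n (g : T -> T') B :
  measurable_fun (setT : set (g_sigma_algebraType (future_generator n))) g -> measurable B ->
  future X n (g @^-1` B).
Proof. by move=> mg mB; rewrite -[_ @^-1` _]setTI; exact: mg. Qed.

Lemma past_X n i : (i < n)%N ->
  measurable_fun (setT : set (g_sigma_algebraType (past_generator n))) (X i).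
Proof.
by move=> ni _ B mB; apply: sub_sigma_algebra; left; exists i => //; exists B.
Qed.

Lemma past_stopped n :
  measurable_fun (setT : set (g_sigma_algebraType (past_generator n)))
    (\1_[set w | (tau w <= n)%N] : T -> R).
Proof. by move=> _ B mB; apply: sub_sigma_algebra; right; exists B. Qed.

Lemma future_X n i : (n <= i)%N ->
  measurable_fun (setT : set (g_sigma_algebraType (future_generator n))) (X i).
Proof.
by move=> ni _ B mB; apply: sub_sigma_algebra; exists i => //; exists B.
Qed.

Lemma pastI n A B : past X tau n A -> past X tau n B -> past X tau n (A `&` B).
Proof. exact: (@measurableI _ (g_sigma_algebraType (past_generator n))). Qed.

Lemma futureI n A B : future X n A -> future X n B -> future X n (A `&` B).
Proof. exact: (@measurableI _ (g_sigma_algebraType (future_generator n))). Qed.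

Lemma measurable_tau (A : set nat) : measurable [set w | A (tau w)].
Proof. by rewrite -[X in measurable X]setTI; exact: measurable_funP. Qed.

Lemma past_measurable n A : past X tau n A -> measurable A.
Proof.
apply: smallest_sub; first exact: sigma_algebra_measurable.
move=> _ [[i _]|] [B mB <-]; first exact: measurable_funP.
have : measurable_fun setT (\1_[set w | (tau w <= n)%N] : T -> R).
  by apply: measurable_indic; exact: (measurable_tau [set m | (m <= n)%N]).
exact.
Qed.

Lemma past_tau_gt n : past X tau n [set w | (n < tau w)%N].
Proof.
rewrite (_ : [set w | _] = (\1_[set w | (tau w <= n)%N] : T -> R) @^-1` [set 0]).
  by apply: past_preimage => //; exact: past_stopped.
apply/seteqP; split => w /=; rewrite (indic_pred R (fun w => tau w <= n)%N).
  by rewrite ltnNge => /negbTE ->.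
by move/eqP; rewrite pnatr_eq0 eqb0 -ltnNge.
Qed.

(** * The walk stopped at tau *)

(** The position at time min(n, tau) of the walk with steps X_i - k. *)
Definition stopped_walk (k : R) n w : R := \sum_(i < n) (i < tau w)%N%:R * (X i w - k).

Lemma measurable_stopped_walk k n : measurable_fun setT (stopped_walk k n).
Proof.
apply: measurable_sum => i; apply: measurable_funM; last exact: measurable_funB.
rewrite (_ : (fun _ => _) = \1_[set w | (i < tau w)%N]).
  by apply: measurable_indic; exact: (measurable_tau [set m | (i < m)%N]).
by apply/funext => w; rewrite (indic_pred R (fun w => i < tau w)%N).
Qed.

Lemma stopped_walk_running k n w : (n <= tau w)%N ->
  stopped_walk k n w = \sum_(i < n) (X i w - k).
Proof.
move=> nt; apply: eq_bigr => i _.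
by rewrite (leq_trans (ltn_ord i) nt) mul1r.
Qed.

Lemma stopped_walk_stopped k n w : (tau w <= n)%N ->
  stopped_walk k n w = \sum_(i < tau w) (X i w - k).
Proof.
move=> tn; rewrite /stopped_walk -(big_mkord predT (fun i => X i w - k)).
rewrite -(big_mkord predT (fun i => (i < tau w)%N%:R * (X i w - k))).
rewrite (big_cat_nat (n := tau w))//= -[RHS]addr0; congr (_ + _).
  by apply: eq_big_nat => i /andP[_ ->]; rewrite mul1r.
by rewrite big_nat big1//; move=> i /andP[ti _]; rewrite ltnNge ti mul0r.
Qed.

(** On the event tau <= n nothing changes.  On its complement the walk moves from
its unstopped position, a function of the first n summands, by a step
independent of that position and of the event, so that the drift bound applies
given the past.  The unstopped position has to be used because the past of
order n records whether tau <= n, but not whether tau <= i for i < n. *)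
Lemma stopped_walk_step (V : R -> R) k c n :
  measurable_fun setT V -> (forall y, 0 <= V y) -> 0 <= c ->
  (forall y, (\int[P]_v (V (y + (X n v - k)))%:E <= (V y + c)%:E)%E) ->
  (\int[P]_w (V (stopped_walk k n.+1 w))%:E <=
   \int[P]_w (V (stopped_walk k n w))%:E + c%:E * P [set w | (n < tau w)%N])%E.
Proof.
move=> mV V0 c0 drift.
pose I : T -> R := \1_[set w | (tau w <= n)%N].
pose J : T -> R := \1_[set w | (n < tau w)%N].
have mtau : measurable [set w | (n < tau w)%N].
  exact: (measurable_tau [set m | (n < m)%N]).
have mJ : measurable_fun setT J by exact: measurable_indic.
have JtE w : J w = (n < tau w)%N%:R by rewrite /J (indic_pred R (fun w => n < tau w)%N).
(* written so as to be nonnegative whatever value the indicator variable takes *)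
have JE w : J w = `|1 - I w|.
  rewrite JtE /I (indic_pred R (fun w => tau w <= n)%N).
  by have [tn|nt] := leqP (tau w) n; rewrite ?subrr ?normr0 ?subr0 ?normr1.
pose Y w := \sum_(i < n) (X i w - k).
have pastY : measurable_fun (setT : set (g_sigma_algebraType (past_generator n)))
    (fun w => (Y w, I w)).
  apply: measurable_fun_pair; last exact: past_stopped.
  by apply: measurable_sum => i; apply: measurable_funB => //; exact: past_X.
have mYI : measurable_fun setT (fun w => (Y w, I w)).
  by move=> _ B mB; rewrite setTI; apply: (past_measurable (n := n)); exact: past_preimage.
pose U : {mfun T >-> (R * R)%type} := HB.pack (fun w => (Y w, I w))
  (isMeasurableFun.Build _ _ _ _ _ mYI).
have mY : measurable_fun setT Y.
  by apply: measurable_sum => i; exact: measurable_funB.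
pose f (u : R * R * R) : \bar R := (`|1 - u.1.2| * V (u.1.1 + (u.2 - k)))%:E.
have mf : measurable_fun setT f.
  apply/measurable_EFinP; apply: measurable_funM.
    apply: measurableT_comp => //; apply: measurable_funB => //.
    by apply: (measurableT_comp (f := snd)) => //; exact: measurable_fst.
  apply: measurableT_comp => //; apply: measurable_funD.
    by apply: (measurableT_comp (f := fst)) => //; exact: measurable_fst.
  by apply: measurable_funB => //; exact: measurable_snd.
have f0 u : (0 <= f u)%E by rewrite lee_fin mulr_ge0.
have Uindep A B : measurable A -> measurable B ->
    P ((U @^-1` A) `&` (X n @^-1` B)) = (P (U @^-1` A) * P (X n @^-1` B))%E.
  move=> mA mB; apply: (indep (n := n)); first exact: past_preimage.
  by apply: future_preimage => //; exact: future_X.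
pose S := stopped_walk k n.
have mS : measurable_fun setT S by exact: measurable_stopped_walk.
have mVS : measurable_fun setT (V \o S) by exact: measurableT_comp.
have SE w : V (stopped_walk k n.+1 w) =
    (1 - J w) * V (S w) + `|1 - I w| * V (Y w + (X n w - k)).
  rewrite -JE JtE; have [nt|tn] := ltnP n (tau w).
    by rewrite subrr mul0r add0r mul1r stopped_walk_running// big_ord_recr.
  rewrite subr0 mul1r mul0r addr0; congr (V _).
  by rewrite /S !stopped_walk_stopped// (leq_trans tn).
have SE' w : V (S w) = (1 - J w) * V (S w) + J w * V (Y w).
  rewrite JtE; have [nt|tn] := ltnP n (tau w).
    by rewrite subrr mul0r add0r mul1r /S stopped_walk_running// ltnW.
  by rewrite subr0 mul1r mul0r addr0.
have J01 w : 0 <= 1 - J w by rewrite JtE; case: (_ < _)%N; rewrite ?subrr ?subr0.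
have J0 w : 0 <= J w by rewrite JtE.
have mJS : measurable_fun setT (fun w => ((1 - J w) * V (S w))%:E).
  by apply/measurable_EFinP; apply: measurable_funM => //; exact: measurable_funB.
have mJY : measurable_fun setT (fun w => (J w * V (Y w))%:E).
  by apply/measurable_EFinP; apply: measurable_funM => //; exact: measurableT_comp.
under eq_integral do rewrite SE EFinD.
rewrite ge0_integralD//=; last 3 first.
- by move=> w _; rewrite lee_fin mulr_ge0.
- by move=> w _; rewrite lee_fin mulr_ge0.
- exact: (measurableT_comp mf (measurable_fun_pair mYI (measurable_funPT (X n)))).
under [X in (_ <= X + _)%E]eq_integral do rewrite SE' EFinD.
rewrite ge0_integralD//=; last 2 first.
- by move=> w _; rewrite lee_fin mulr_ge0.
- by move=> w _; rewrite lee_fin mulr_ge0.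
rewrite -[leRHS]addeA; apply: leeD2l.
have -> : (c%:E * P [set w | (n < tau w)%N])%E = (\int[P]_w (c * J w)%:E)%E.
  under eq_integral do rewrite EFinM.
  rewrite ge0_integralZl//; last 2 first.
  - exact/measurable_EFinP.
  - by move=> w _; rewrite lee_fin.
  by rewrite integral_indic// setIT.
rewrite -ge0_integralD//=; last 3 first.
- by move=> w _; rewrite lee_fin mulr_ge0.
- by move=> w _; rewrite lee_fin mulr_ge0.
- by apply/measurable_EFinP; exact: measurable_funM.
pose g (u : R * R) : \bar R := (`|1 - u.2| * (V u.1 + c))%:E.
have mg : measurable_fun setT g.
  apply/measurable_EFinP; apply: measurable_funM.
    by apply: measurableT_comp => //; exact: measurable_funB.
  by apply: measurable_funD => //; exact: measurableT_comp.
rewrite [leRHS](eq_integral (fun w => g (U w))); last first.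
  by move=> w _; rewrite /g /= -JE -EFinD mulrDr [c * _]mulrC.
apply: (ge0_integral_independent_le (P := P) (U := U) (Z := X n) (f := f) (g := g) Uindep mf f0 mg).
move=> u; rewrite /f/g /=; under eq_integral do rewrite EFinM.
have mVX : measurable_fun setT (fun v => (V (u.1 + (X n v - k)))%:E).
  apply/measurable_EFinP; apply: measurableT_comp => //.
  by apply: measurable_funD => //; exact: measurable_funB.
rewrite ge0_integralZl//; last by move=> v _; rewrite lee_fin.
by rewrite EFinM lee_wpmul2l// lee_fin.
Qed.

Lemma stopped_walk_expectation (V : R -> R) k c n :
  measurable_fun setT V -> (forall y, 0 <= V y) -> 0 <= c ->
  (forall i y, (\int[P]_v (V (y + (X i v - k)))%:E <= (V y + c)%:E)%E) ->
  (\int[P]_w (V (stopped_walk k n w))%:E <=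
   (V 0)%:E + c%:E * \sum_(i < n) P [set w | (i < tau w)%N])%E.
Proof.
move=> mV V0 c0 drift; elim: n => [|n IH].
  rewrite big_ord0 mule0 adde0; under eq_integral do rewrite /stopped_walk big_ord0.
  by rewrite integral_cst//= probability_setT mule1.
have h := stopped_walk_step mV V0 c0 (drift n).
apply: (le_trans h).
rewrite big_ord_recr/= ge0_muleDr ?sume_ge0// addeA leeD2r//.
Qed.

Lemma sum_indicator_lt (n t : nat) :
  \sum_(0 <= i < n) ((i < t)%N%:R : R) = (minn n t)%:R.
Proof.
elim: n => [|n IH]; first by rewrite big_geq// min0n.
rewrite big_nat_recr//= IH -natrD; congr (_%:R).
by have [nt|tn] := ltnP n t; lia.
Qed.

Lemma expectation_tau :
  ('E_P[fun w => (tau w)%:R] = \sum_(i <oo) P [set w | (i < tau w)%N])%E.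
Proof.
have E i : P [set w | (i < tau w)%N] = (\int[P]_w ((i < tau w)%N%:R)%:E)%E.
  under eq_integral do rewrite -(indic_pred R (fun w => i < tau w)%N).
  by rewrite integral_indic ?setIT//; exact: (measurable_tau [set m | (i < m)%N]).
rewrite unlock; under eq_eseriesr do rewrite E.
rewrite -integral_nneseries//; last first.
  move=> i; apply/measurable_EFinP.
  rewrite (_ : (fun w => _) = \1_[set w | (i < tau w)%N]).
    by apply: measurable_indic; exact: (measurable_tau [set m | (i < m)%N]).
  by apply/funext => w; rewrite (indic_pred R (fun w => i < tau w)%N).
apply: eq_integral => w _; apply/esym; apply: lim_near_cst => //.
near=> n; rewrite sumEFin sum_indicator_lt; congr (_%:R%:E).
by apply/minn_idPr; near: n; exact: nbhs_infty_ge.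
Unshelve. all: by end_near.
Qed.

Lemma sum_tau_le n :
  (\sum_(i < n) P [set w | (i < tau w)%N] <= 'E_P[fun w => (tau w)%:R])%E.
Proof.
rewrite expectation_tau -(big_mkord predT (fun i => P [set w | (i < tau w)%N])).
exact: nneseries_lim_ge.
Qed.

Lemma sum_tau_ge e : ('E_P[fun w => (tau w)%:R] < +oo)%E -> 0 < e ->
  exists n, fine 'E_P[fun w => (tau w)%:R] - e <=
    \sum_(i < n) fine (P [set w | (i < tau w)%N]).
Proof.
move=> Efin e0.
have cvgS : (\sum_(0 <= i < n) P [set w | (i < tau w)%N] @[n --> \oo] -->
    'E_P[fun w => (tau w)%:R])%E.
  rewrite expectation_tau; exact: is_cvg_nneseries.
have Ef : ('E_P[fun w => (tau w)%:R])%E \is a fin_num.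
  by rewrite ge0_fin_numE// expectation_ge0.
move: cvgS; rewrite -[X in _ --> X]fineK// => /fine_cvgP[_ /cvgrPdist_le/(_ _ e0)].
move=> [n _ /(_ n (leqnn n))] /= Hn; exists n.
move: Hn; rewrite big_mkord -sum_fine; last first.
  by move=> i _; apply: fin_num_measure; exact: (measurable_tau [set m | (i < m)%N]).
by rewrite ler_distl => /andP[_ ]; lra.
Qed.

End stopped.

(** * Bounds for a fixed level *)

Section bounds.
Context d {T : measurableType d} {R : realType} (P : probability T R).
Variables (xi : {RV P >-> R}) (X : nat -> {RV P >-> R}) (tau : {RV P >-> nat}).
Hypothesis iid : iid_copies xi X.
Hypothesis indep : independent_of_future X tau.

Local Notation G := (tail (distribution P xi)).

Lemma tail_antitone x y : x <= y -> G y <= G x.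
Proof.
move=> xy; rewrite /tail fine_le ?fin_num_measure//.
by rewrite le_measure ?inE//; exact: subset_itvr.
Qed.

Lemma tail_le1 x : G x <= 1.
Proof. by rewrite -lee_fin fineK ?fin_num_measure// probability_le1. Qed.

Lemma tail_cvg0 : G x @[x --> +oo] --> 0.
Proof. exact: (fine_cvg (cvg_ccdfy0 xi)). Qed.

Lemma measurable_above i a : measurable [set v | a < X i v].
Proof.
rewrite (_ : [set v | _] = X i @^-1` `]a, +oo[); first exact: measurable_funPTI.
by apply/seteqP; split => v /=; rewrite in_itv/= andbT.
Qed.

Lemma probability_above i a : P [set v | a < X i v] = (G a)%:E.
Proof.
rewrite /tail fineK ?fin_num_measure// -[RHS](iid.2 i `]a, +oo[%classic (measurable_itv _)).
rewrite (_ : [set v | _] = X i @^-1` `]a, +oo[)//.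
by apply/seteqP; split => v /=; rewrite in_itv/= andbT.
Qed.

Lemma integral_above i a :
  (\int[P]_v (\1_[set v | a < X i v] v)%:E = (G a)%:E)%E.
Proof.
rewrite integral_indic ?setIT//; last exact: measurable_above.
exact: probability_above.
Qed.

(** One step of the walk crosses the threshold of each indicator in lyapunov with
the probability that stands in its place in lyapunov_step. *)
Lemma lyapunov_integral c n k x y i : 0 <= c ->
  (\int[P]_v (lyapunov G c n (x - (y + (X i v - k%:R))))%:E =
   (lyapunov_step G c n k (x - y))%:E)%E.
Proof.
move=> c0.
have G0 j : 0 <= G j by rewrite /tail fine_ge0.
have E v : lyapunov G c n (x - (y + (X i v - k%:R))) =
  \1_[set v | x - y + k%:R < X i v] v +
  \sum_(1 <= j < n.+1) c * G j%:R * \1_[set v | x - y - j%:R + k%:R < X i v] v.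
  rewrite /lyapunov mulr_sumr; congr (_ + _).
    by rewrite indic_pred; congr (nat_of_bool _)%:R; apply/idP/idP; lra.
  apply: eq_bigr => j _; rewrite indic_pred mulrA.
  by congr (_ * (nat_of_bool _)%:R); apply/idP/idP; lra.
under eq_integral do rewrite E EFinD -sumEFin.
have mi a : measurable_fun setT (fun v => (\1_[set v | a < X i v] v)%:E : \bar R).
  by apply/measurable_EFinP; apply: measurable_indic; exact: measurable_above.
have mi' a : measurable_fun setT (\1_[set v | a < X i v] : T -> R).
  by apply: measurable_indic; exact: measurable_above.
have mj j a : measurable_fun setT (fun v => (c * G j * \1_[set v | a < X i v] v)%:E : \bar R).
  by apply/measurable_EFinP; exact: measurable_funM.
rewrite ge0_integralD//; last 2 first.
- by move=> v _; rewrite sume_ge0// => j _; rewrite lee_fin !mulr_ge0.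
- by apply: emeasurable_sum => j.
rewrite ge0_integral_sum//; last first.
  by move=> j v _; rewrite lee_fin !mulr_ge0.
rewrite integral_above /lyapunov_step EFinD; congr (_ + _)%E.
rewrite mulr_sumr -sumEFin; apply: eq_bigr => j _.
under eq_integral do rewrite EFinM.
rewrite ge0_integralZl//; last by rewrite lee_fin mulr_ge0.
by rewrite integral_above -EFinM mulrA.
Qed.

Lemma stopped_sum_trunc (x k : R) m :
  [set w | x < \sum_(i < tau w) (X i w - k)] `&` [set w | (tau w <= m)%N] =
  [set w | x < stopped_walk X tau k m w] `&` [set w | (tau w <= m)%N].
Proof.
by apply/seteqP; split => w /= [xw tm]; split; move: xw => //; rewrite stopped_walk_stopped.
Qed.

Lemma measurable_gt (f : T -> R) a : measurable_fun setT f -> measurable [set w | a < f w].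
Proof.
move=> mf; rewrite (_ : [set w | _] = f @^-1` `]a, +oo[).
  by rewrite -[X in measurable X]setTI; exact: mf.
by apply/seteqP; split => v /=; rewrite in_itv/= andbT.
Qed.

Lemma measurable_stopped_sum (x k : R) m :
  measurable ([set w | x < \sum_(i < tau w) (X i w - k)] `&` [set w | (tau w <= m)%N]).
Proof.
rewrite stopped_sum_trunc; apply: measurableI.
  exact/measurable_gt/measurable_stopped_walk.
exact: (measurable_tau tau [set n | (n <= m)%N]).
Qed.

Lemma measurable_random_sum_gt (x : R) : measurable [set w | x < random_sum X tau w].
Proof.
rewrite (_ : [set w | _] = \bigcup_m
  ([set w | x < \sum_(i < tau w) (X i w - 0)] `&` [set w | (tau w <= m)%N])).
  by apply: bigcup_measurable => m _; exact: measurable_stopped_sum.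
have E w : \sum_(i < tau w) (X i w - 0) = random_sum X tau w.
  by apply: eq_bigr => i _; rewrite subr0.
apply/seteqP; split => w /=; first by move=> xw; exists (tau w) => //=; rewrite E.
by move=> [m _ /= []]; rewrite E.
Qed.

(** Above the level x the Lyapunov function is at least 1, and it starts from 0, so
that its mean at time m is both an upper bound for the probability and at most
b times the mean number of steps made. *)
Lemma stopped_walk_tail (c b x : R) n k m : 0 <= c -> 0 <= b -> n%:R <= x ->
  (forall s, lyapunov_step G c n k s <= lyapunov G c n s + b) ->
  (P ([set w | (x < \sum_(i < tau w) (X i w - k%:R))%R] `&`
      [set w | (tau w <= m)%N]) <= b%:E * 'E_P[fun w => (tau w)%:R])%E.
Proof.
move=> c0 b0 nx drift.
have G0 j : 0 <= G j by rewrite /tail fine_ge0.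
pose V y := lyapunov G c n (x - y).
have V0 y : 0 <= V y by rewrite addr_ge0// mulr_ge0// sumr_ge0// => j _; rewrite mulr_ge0.
have mV : measurable_fun setT V.
  apply: nondecreasing_measurable => // y z yz.
  have le_ind (a : R) : (x - y < a)%R%:R <= (x - z < a)%R%:R :> R.
    rewrite ler_nat; have [ya|//] := ltP (x - y) a.
    by rewrite (_ : x - z < a)//; lra.
  by rewrite lerD// ler_wpM2l// ler_sum// => j _; rewrite ler_wpM2l.
have mE := measurable_stopped_sum x k%:R m.
have h i y : (\int[P]_v (V (y + (X i v - k%:R)))%:E <= (V y + b)%:E)%E.
  by rewrite lyapunov_integral// lee_fin; exact: drift.
apply: (le_trans _ (le_trans
  (stopped_walk_expectation indep m mV V0 b0 h) _)).
  rewrite -[X in P X]setIT -(integral_indic P measurableT mE).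
  apply: ge0_le_integral => //=.
  - by apply/measurable_EFinP; exact: measurable_indic.
  - apply/measurable_EFinP; apply: measurableT_comp => //.
    exact: measurable_stopped_walk.
  move=> w _; rewrite lee_fin indicE; have [wE|_] := boolP (w \in _); last exact: V0.
  move: wE => /set_mem; rewrite stopped_sum_trunc => -[/= xw _].
  rewrite /V /lyapunov subr_lt0 xw lerDl mulr_ge0// sumr_ge0// => j _.
  by rewrite mulr_ge0.
by rewrite /V subr0 lyapunov_beyond// add0e lee_wpmul2l ?lee_fin// sum_tau_le.
Qed.

Lemma ge0_integral_iid i (f : R -> \bar R) : measurable_fun setT f ->
  (forall y, 0 <= f y)%E -> (\int[P]_w f (X i w) = \int[P]_w f (xi w))%E.
Proof.
move=> mf f0; rewrite -!(ge0_integral_distribution (P := P))//.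
by apply: eq_measure_integral => B mB _; exact: (iid.2 i).
Qed.

Lemma absolute_sum_tail (M t : R) p l : ('E_P[fun w => `|xi w|%R] <= M%:E)%E -> 0 < t ->
  fine (P [set w | t < \sum_(p <= i < p + l) `|X i w|]) <= l%:R * M / t.
Proof.
move=> EM t0.
pose Y w := \sum_(p <= i < p + l) `|X i w|.
have mX i : measurable_fun setT (fun w => `|X i w|) by exact: measurableT_comp.
have Y0 w : 0 <= Y w by rewrite sumr_ge0.
have mY : measurable_fun setT Y.
  by apply: measurable_sum => i; exact: mX.
have mE : measurable [set w | t < Y w] by exact: measurable_gt.
rewrite ler_pdivlMr// -lee_fin EFinM fineK ?fin_num_measure//.
have -> : (P [set w | (t < Y w)%R] * t%:E = \int[P]_w (t * \1_[set w | (t < Y w)%R] w)%:E)%E.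
  under eq_integral do rewrite EFinM.
  rewrite ge0_integralZl ?integral_indic ?setIT ?lee_fin 1?muleC ?ltW//.
  by apply/measurable_EFinP; exact: measurable_indic.
apply: (@le_trans _ _ (\int[P]_w (Y w)%:E)%E).
  apply: ge0_le_integral => //=.
  - by move=> w _; rewrite lee_fin mulr_ge0// ltW.
  - by apply/measurable_EFinP; apply: measurable_funM => //; exact: measurable_indic.
  - exact/measurable_EFinP.
  move=> w _; rewrite lee_fin indic_pred; have [tY|_] := ltP t (Y w).
    by rewrite mulr1 ltW.
  by rewrite mulr0.
under eq_integral do rewrite -sumEFin.
rewrite ge0_integral_sum//; last first.
  by move=> i; exact/measurable_EFinP.
apply: (@le_trans _ _ (\sum_(p <= i < p + l) M%:E)%E).
  apply: lee_sum => i _; rewrite (ge0_integral_iid i (f := fun y => `|y|%:E))//.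
  + by rewrite unlock in EM.
  + exact/measurable_EFinP.
by rewrite sumEFin sumr_const_nat addKn mulr_natl.
Qed.

(** The big jump is the summand X n.  The summands before it are bounded in sum,
and those after it are controlled over a horizon of m steps, which contains all
indices up to tau when tau <= m. *)
Definition one_jump (a b u : R) m n : set T :=
  ([set w | (n < tau w)%N] `&` [set w | \sum_(0 <= i < n) `|X i w| <= a]) `&`
  ([set w | u < X n w] `&` [set w | \sum_(n.+1 <= i < n.+1 + m) `|X i w| <= b]).

Lemma one_jump_subset a b x m n :
  one_jump a b (x + a + b) m n `&` [set w | (tau w <= m)%N] `<=`
  [set w | x < random_sum X tau w].
Proof.
move=> w [[[/= nt Sa] [/= Xu Sb]] /= tm].
have {}Sb : \sum_(n.+1 <= i < n.+1 + m) `|X i w| <= b by exact: Sb.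
rewrite /random_sum -(big_mkord predT (fun i => X i w)).
rewrite (big_cat_nat (n := n))//= ?(ltnW nt)// [X in _ + X]big_ltn//.
have lo : - \sum_(0 <= i < n) `|X i w| <= \sum_(0 <= i < n) X i w.
  by rewrite -sumrN; apply: ler_sum => i _; rewrite lerNl ler_normr lexx orbT.
have hi : - \sum_(n.+1 <= i < n.+1 + m) `|X i w| <= \sum_(n.+1 <= i < tau w) X i w.
  apply: (@le_trans _ _ (- \sum_(n.+1 <= i < tau w) `|X i w|)).
    rewrite lerN2 [leRHS](big_cat_nat (n := tau w))//=; last by lia.
    by rewrite lerDl sumr_ge0.
  by rewrite -sumrN; apply: ler_sum => i _; rewrite lerNl ler_normr lexx orbT.
by lra.
Qed.

(** A later jump requires all earlier summands, including the first big one, to be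
at most a. *)
Lemma one_jump_disjoint a b u m : 0 <= a -> a < u -> trivIset setT (one_jump a b u m).
Proof.
move=> a0 au; apply: ltn_trivIset => q p pq.
apply/seteqP; split => // w [[_ [/= Xp _]] [[_ /= Sa] _]].
have := ler_norm (X p w).
have : `|X p w| <= \sum_(0 <= i < q) `|X i w|.
  rewrite (big_cat_nat (n := p))//= ?(ltnW pq)// [X in _ + X]big_ltn//= addrCA lerDl.
  by rewrite addr_ge0// sumr_ge0.
move=> h1 h2; have : u < u by lra.
by rewrite ltxx.
Qed.

Lemma measurable_sum_norm_le p q a : measurable [set w | \sum_(p <= i < q) `|X i w| <= a].
Proof.
rewrite (_ : [set w | _] = ~` [set w | a < \sum_(p <= i < q) `|X i w|]).
  apply: measurableC; apply: measurable_gt.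
  by apply: measurable_sum => i; exact: measurableT_comp.
by apply/seteqP; split => w /=; rewrite leNgt => /negP.
Qed.

Lemma measurable_one_jump a b u m n : measurable (one_jump a b u m n).
Proof.
apply: measurableI; apply: measurableI.
- exact: (measurable_tau tau [set i | (n < i)%N]).
- exact: measurable_sum_norm_le.
- exact: measurable_above.
- exact: measurable_sum_norm_le.
Qed.

(** Two applications of the independence of the past and the future: at time n,
which separates n < tau and the first n summands from the rest, and at time
n + 1, which separates the big jump from the subsequent summands. *)
Lemma probability_one_jump a b u m n :
  P (one_jump a b u m n) =
  (P ([set w | (n < tau w)%N] `&` [set w | (\sum_(0 <= i < n) `|X i w| <= a)%R]) *
   ((G u)%:E * P [set w | (\sum_(n.+1 <= i < n.+1 + m) `|X i w| <= b)%R]))%E.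
Proof.
have above c : [set w | u < X c w] = X c @^-1` `]u, +oo[.
  by apply/seteqP; split => v /=; rewrite in_itv/= andbT.
have below p q c : [set w | \sum_(p <= i < q) `|X i w| <= c] =
    (fun w => \sum_(p <= i < q) `|X i w|) @^-1` `]-oo, c].
  by apply/seteqP; split => v /=; rewrite in_itv.
have past_sum : past X tau n [set w | \sum_(0 <= i < n) `|X i w| <= a].
  rewrite below; under [X in X @^-1` _]eq_fun do rewrite big_mkord.
  apply: past_preimage => //.
  by apply: measurable_sum => i; apply: measurableT_comp => //; exact: past_X.
have future_sum p q : (q <= p)%N ->
    future X q [set w | \sum_(p <= i < p + m) `|X i w| <= b].
  move=> qp; rewrite below.
  rewrite (_ : (fun w => _) = fun w => \sum_(i < m) `|X (p + i)%N w|).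
    apply: future_preimage => //; apply: measurable_sum => i.
    by apply: measurableT_comp => //; apply: future_X; rewrite (leq_trans qp)// leq_addr.
  apply/funext => w; rewrite -{1}[p]add0n big_addn addKn big_mkord.
  by apply: eq_bigr => i _; rewrite addnC.
have past_above : past X tau n.+1 [set w | u < X n w].
  by rewrite above; apply: past_preimage => //; exact: past_X.
have future_above : future X n [set w | u < X n w].
  by rewrite above; apply: future_preimage => //; exact: future_X.
rewrite (indep (n := n)).
- by rewrite (indep past_above (future_sum _ _ (leqnn n.+1))) (probability_above n u).
- apply: pastI past_sum; exact: past_tau_gt.
- exact: futureI future_above (future_sum _ _ (leqnSn n)).
Qed.

(** The level of the jump allows for a loss of a before it and of k * m after it.
By Markov's inequality the sums of absolute values exceed these losses with
probability at most n * M / a and M / k. *)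
Lemma one_jump_bound (M a x : R) (k m n : nat) :
  ('E_P[fun w => `|xi w|%R] <= M%:E)%E -> 0 < a -> (0 < k)%N -> M <= k%:R ->
  (fine (P [set w | (n < tau w)%N]) - n%:R * M / a) * (1 - M / k%:R) *
    G (x + a + k%:R * m%:R)
  <= fine (P (one_jump a (k%:R * m%:R) (x + a + k%:R * m%:R) m n)).
Proof.
move=> EM a0 k0 Mk.
have kR : 0 < k%:R :> R by rewrite ltr0n.
have mt : measurable [set w | (n < tau w)%N].
  exact: (measurable_tau tau [set i | (n < i)%N]).
set E := [set w | (n < tau w)%N] `&` [set w | \sum_(0 <= i < n) `|X i w| <= a].
have mE : measurable E by apply: measurableI => //; exact: measurable_sum_norm_le.
set H := [set w | \sum_(n.+1 <= i < n.+1 + m) `|X i w| <= k%:R * m%:R].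
have mH : measurable H by exact: measurable_sum_norm_le.
have mgt p q c : measurable [set w | c < \sum_(p <= i < q) `|X i w|].
  apply: measurable_gt; apply: measurable_sum => i; exact: measurableT_comp.
rewrite probability_one_jump -/E -/H !fineM ?fin_numM ?fin_num_measure// [leRHS]mulrCA.
rewrite mulrC ler_wpM2l ?fine_ge0//.
have PE : fine (P [set w | (n < tau w)%N]) - n%:R * M / a <= fine (P E).
  rewrite lerBlDr; apply: le_trans (lerD (lexx _) (absolute_sum_tail 0 n EM a0)).
  rewrite -fineD ?fin_num_measure// fine_le ?fin_numD ?fin_num_measure//; last first.
    apply: le_trans (measureU2 P mE (mgt 0 n a)).
    rewrite le_measure ?inE//; first exact: measurableU.
    move=> w /= nt; have [Sa|aS] := leP (\sum_(0 <= i < n) `|X i w|) a; first by left.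
    by right.
have PH : 1 - M / k%:R <= fine (P H).
  have -> : fine (P H) = 1 - fine (P (~` H)).
    by rewrite probability_setC// fineB ?fin_num_measure//= subKr.
  rewrite lerB//.
  have -> : ~` H = [set w | k%:R * m%:R < \sum_(n.+1 <= i < n.+1 + m) `|X i w|].
    by apply/seteqP; split => w /=; rewrite ltNge => /negP.
  have M0 : 0 <= M by rewrite -lee_fin (le_trans _ EM)// expectation_ge0.
  case: (posnP m) => [->|m0].
    rewrite (_ : [set w | _] = set0) ?measure0 ?divr_ge0// ?ltW//.
    by apply/seteqP; split => // w /=; rewrite addn0 mulr0 big_geq// ltxx.
  have mR : 0 < m%:R :> R by rewrite ltr0n.
  rewrite (le_trans (absolute_sum_tail n.+1 m EM _)) ?mulr_gt0//.
  by rewrite [k%:R * _]mulrC -mulf_div divff ?gt_eqF// mul1r.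
apply: (@le_trans _ _ (fine (P E) * (1 - M / k%:R))).
  by rewrite ler_wpM2r// subr_ge0 ler_pdivrMr// mul1r.
by rewrite ler_wpM2l ?fine_ge0.
Qed.

Lemma random_sum_lower (M a x : R) (k m N : nat) :
  ('E_P[fun w => `|xi w|%R] <= M%:E)%E -> 0 < a -> a < x -> (0 < k)%N -> M <= k%:R ->
  (\sum_(n < N) fine (P [set w | (n < tau w)%N]) - N%:R * N%:R * M / a) *
    (1 - M / k%:R) * G (x + a + k%:R * m%:R)
  <= fine (P [set w | x < random_sum X tau w]) + fine (P [set w | (m < tau w)%N]).
Proof.
move=> EM a0 ax k0 Mk; set b := k%:R * m%:R; set u := x + a + b.
have kR : 0 < k%:R :> R by rewrite ltr0n.
have M0 : 0 <= M by rewrite -lee_fin (le_trans _ EM)// expectation_ge0.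
have mt : measurable [set w | (m < tau w)%N].
  exact: (measurable_tau tau [set i | (m < i)%N]).
have mS := measurable_random_sum_gt x.
have b0 : 0 <= b by rewrite mulr_ge0.
have tI : trivIset setT (one_jump a b u m).
  by apply: one_jump_disjoint; [exact: ltW|rewrite /u; lra].
have mF n : measurable (one_jump a b u m n) by exact: measurable_one_jump.
apply: (@le_trans _ _ (\sum_(n < N) fine (P (one_jump a b u m n)))).
  have -> : \sum_(n < N) fine (P [set w | (n < tau w)%N]) - N%:R * N%:R * M / a =
      \sum_(n < N) (fine (P [set w | (n < tau w)%N]) - N%:R * M / a).
    by rewrite sumrB sumr_const card_ord -(mulr_natl (_ * M / a)) !mulrA.
  rewrite !mulr_suml; apply: ler_sum => n _.
  apply: le_trans (one_jump_bound x m n EM a0 k0 Mk).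
  rewrite ler_wpM2r ?fine_ge0// ler_wpM2r//.
    by rewrite subr_ge0 ler_pdivrMr// mul1r.
  rewrite lerB// ler_wpM2r ?invr_ge0 ?(ltW a0)// ler_wpM2r// ler_nat.
  exact: ltnW.
rewrite sum_fine; last by move=> n _; rewrite fin_num_measure.
rewrite -(measure_bigsetU P mF tI) -fineD ?fin_num_measure//.
have mU : measurable (\big[setU/set0]_(n < N) one_jump a b u m n).
  exact: bigsetU_measurable.
rewrite fine_le ?fin_numD ?fin_num_measure//.
apply: le_trans (measureU2 P mS mt).
rewrite le_measure ?inE//; first exact: measurableU.
rewrite -bigcup_mkord => w [n _ Fw].
have [tm|mt'] := leqP (tau w) m; last by right.
by left; apply: (@one_jump_subset a b x m n).
Qed.

End bounds.

(** * The two asymptotic bounds *)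

Section limits.
Context d {T : measurableType d} {R : realType} (P : probability T R).
Variables (xi : {RV P >-> R}) (X : nat -> {RV P >-> R}) (tau : {RV P >-> nat}).
Hypothesis iid : iid_copies xi X.
Hypothesis indep : independent_of_future X tau.

Local Notation G := (tail (distribution P xi)).
Local Notation Etau := (fine ('E_P[fun w => (tau w)%:R])%E).

Hypothesis G_gt0 : forall x, 0 < G x.
Hypothesis tau_fin : ('E_P[fun w => (tau w)%:R] < +oo)%E.
Hypothesis xi_fin : ('E_P[fun w => `|xi w|%R] < +oo)%E.

Lemma Etau_fin_num : ('E_P[fun w => (tau w)%:R])%E \is a fin_num.
Proof. by rewrite ge0_fin_numE// expectation_ge0. Qed.

Lemma Etau_ge0 : 0 <= Etau.
Proof. by rewrite fine_ge0// expectation_ge0. Qed.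

Variable h : R -> R.
Hypothesis h_homo : {homo h : x y / x <= y}.
Hypothesis h_ge0 : forall x, 0 <= h x.
Hypothesis h_up : asymp_eq (fun x => G (x + h x)) G.
Hypothesis h_down : asymp_eq (fun x => G (x - h x)) G.
Hypothesis h_tau : forall e, 0 < e ->
  \forall x \near +oo, fine (P [set w | h x < (tau w)%:R]) <= e * G x.
Hypothesis G_long : forall c e, 0 < e -> \forall x \near +oo, G (x - c) <= (1 + e) * G x.

Lemma tau_gt_truncn x : [set w | (Num.truncn (h x) < tau w)%N] = [set w | h x < (tau w)%:R].
Proof.
apply/seteqP; split => w /=.
  by rewrite -(ler_nat R); apply: lt_le_trans; exact: truncnS_gt.
move=> xt; rewrite ltnNge; apply/negP => tm; move: xt.
rewrite ltNge (le_trans (y := (Num.truncn (h x))%:R)) ?ler_nat//.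
by rewrite truncn_le.
Qed.

(** The level y and the horizon floor(h(y)) are chosen together, so that both
P(tau > h(y)) = o(G(y)) and y + k * h(y) <= x hold. *)
Lemma random_sum_limsup e : in_Sstar (distribution P xi) -> 0 < e ->
  \forall x \near +oo,
    fine (P [set w | x < random_sum X tau w]) <= (e + (1 + e) ^+ 2 * Etau) * (1 + e) * G x.
Proof.
move=> [_ _ Sstar] e0.
have [C C0 GC] := convolution_bound_sum (@tail_antitone _ _ _ _ xi) G_gt0
  (@tail_le1 _ _ _ _ xi) Sstar.
have [k [c c0 drift]] := lyapunov_drift (@tail_antitone _ _ _ _ xi) G_gt0
  (@tail_le1 _ _ _ _ xi) C0 e0 (@tail_cvg0 _ _ _ _ xi) G_long GC.
pose f x := x - h x.
have fG := asymp_eq_iter (@tail_antitone _ _ _ _ xi) G_gt0 (@tail_cvg0 _ _ _ _ xi) k h_down.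
have fy := asymp_eq_cvg_pinfty (@tail_antitone _ _ _ _ xi) G_gt0 (@tail_cvg0 _ _ _ _ xi) fG.
near=> x.
have Gy : G (iter k f x) <= (1 + e) * G x by near: x; exact: asymp_eq_le.
have hy : fine (P [set w | h (iter k f x) < (tau w)%:R]) <= e * G (iter k f x).
  near: x; exact: (fy _ (h_tau e0)).
have y0 : 0 <= iter k f x.
  near: x; apply: (fy [set y | 0 <= y]); apply: nbhs_pinfty_ge; exact: num_real.
have dy : forall s, lyapunov_step G c (Num.truncn (iter k f x)) k s <=
    lyapunov G c (Num.truncn (iter k f x)) s + (1 + e) ^+ 2 * G (iter k f x).
  near: x; exact: (fy _ drift).
set y := iter k f x in Gy hy y0 dy.
have yx : y + k%:R * h y <= x by exact: iter_shift_down.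
set m := Num.truncn (h y).
have b0 : 0 <= (1 + e) ^+ 2 * G y by rewrite mulr_ge0 ?exprn_ge0 ?(ltW (G_gt0 _))//; lra.
have ny : (Num.truncn y)%:R <= y by rewrite truncn_le.
have up := stopped_walk_tail iid indep m c0 b0 ny dy.
have mt : measurable [set w | (m < tau w)%N].
  exact: (measurable_tau tau [set i | (m < i)%N]).
have mA := measurable_stopped_sum X tau y k%:R m.
set A := _ `&` _ in up mA.
have : fine (P [set w | x < random_sum X tau w]) <=
    fine (P [set w | (m < tau w)%N]) + (1 + e) ^+ 2 * G y * Etau.
  have up' : fine (P A) <= (1 + e) ^+ 2 * G y * Etau.
    by rewrite -lee_fin EFinM !fineK ?fin_num_measure ?Etau_fin_num.
  apply: le_trans (lerD (lexx _) up').
  rewrite -fineD ?fin_num_measure// fine_le ?fin_numD ?fin_num_measure//.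
  - exact: measurable_random_sum_gt.
  apply: le_trans (measureU2 P mt mA).
  rewrite le_measure ?inE//; first exact: measurable_random_sum_gt.
    exact: measurableU.
  move=> w /= xS; have [tm|mt'] := leqP (tau w) m; last by left.
  right; split => //=; rewrite big_split/= sumrN sumr_const card_ord -[_ *+ tau w]mulr_natr.
  apply: (le_lt_trans _ (_ : x - k%:R * h y < _)); first by lra.
  rewrite ltr_leB// ler_wpM2l//.
  by rewrite (le_trans (y := m%:R)) ?ler_nat// truncn_le.
rewrite tau_gt_truncn => /le_trans; apply.
have E0 := Etau_ge0.
apply: (@le_trans _ _ ((e + (1 + e) ^+ 2 * Etau) * G y)).
  by rewrite mulrDl lerD// mulrAC.
rewrite -mulrA ler_wpM2l// addr_ge0 ?(ltW e0)// mulr_ge0// exprn_ge0//; lra.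
Unshelve. all: by end_near.
Qed.

(** N is chosen to exhaust the mean of tau, k and a to make the losses from Markov's
inequality at most e.  As Etau - 2 * e may be negative, the factors close to 1 are
compared through Etau * (1 - f * g) rather than by a product of lower bounds. *)
Lemma random_sum_liminf e : 0 < e -> e <= 1 ->
  \forall x \near +oo,
    (Etau - e * (3 + 3 * Etau)) * G x <= fine (P [set w | x < random_sum X tau w]).
Proof.
move=> e0 e1.
set M := fine ('E_P[fun w => `|xi w|%R])%E.
have EM : ('E_P[fun w => `|xi w|%R] <= M%:E)%E.
  by rewrite fineK// ge0_fin_numE// expectation_ge0.
have M0 : 0 <= M by rewrite fine_ge0// expectation_ge0.
have [N SN] := sum_tau_ge tau_fin e0.
set S := bigop _ _ _ in SN.
have SE : S <= Etau.
  rewrite /S sum_fine; last first.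
    by move=> i _; rewrite fin_num_measure//; exact: (measurable_tau tau [set j | (i < j)%N]).
  rewrite fine_le ?sum_tau_le ?Etau_fin_num//.
  apply/sum_fin_numP => i _ _; rewrite fin_num_measure//.
  exact: (measurable_tau tau [set j | (i < j)%N]).
set k := (Num.truncn (M / e)).+1.
have kR : 0 < k%:R :> R by rewrite ltr0n.
have Mk : M / k%:R <= e.
  by rewrite ler_pdivrMr// mulrC -ler_pdivrMr// ltW// truncnS_gt.
have Mk' : M <= k%:R by move: Mk; rewrite ler_pdivrMr// => /le_trans; apply; rewrite ler_piMl// ltW.
set a := N%:R * N%:R * M / e + 1.
have a0 : 0 < a by rewrite ltr_wpDl// divr_ge0 ?mulr_ge0// ltW.
have NMa : N%:R * N%:R * M / a <= e.
  by rewrite ler_pdivrMr// -ler_pdivrMl// [e^-1 * _]mulrC lerDl.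
have fG := asymp_eq_iter (@tail_antitone _ _ _ _ xi) G_gt0 (@tail_cvg0 _ _ _ _ xi) k h_up.
have fy := asymp_eq_cvg_pinfty (@tail_antitone _ _ _ _ xi) G_gt0 (@tail_cvg0 _ _ _ _ xi) fG.
have [B [_ GB]] := G_long a e0.
near=> x.
have ax : a < x by near: x; apply: nbhs_pinfty_gt; exact: num_real.
have hx : fine (P [set w | h x < (tau w)%:R]) <= e * G x by near: x; exact: h_tau.
have Gz : (1 - e) * G x <= G (iter k (fun z => z + h z) x) by near: x; exact: asymp_eq_ge.
have zB : B < iter k (fun z => z + h z) x.
  near: x; apply: (fy [set y | B < y]); apply: nbhs_pinfty_gt; exact: num_real.
set z := iter k _ x in Gz zB.
set m := Num.truncn (h x).
have low := random_sum_lower iid indep m N EM a0 ax (ltn0Sn _) Mk'.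
rewrite -/k tau_gt_truncn -/S in low.
set u := x + a + k%:R * m%:R in low.
have xu : G u <= G x by apply: tail_antitone; rewrite /u -addrA lerDl addr_ge0 ?(ltW a0)// mulr_ge0.
have uz : u <= z + a.
  have : x + k%:R * h x <= z by exact: iter_shift_up.
  have : k%:R * m%:R <= k%:R * h x by rewrite ler_wpM2l// truncn_le.
  by rewrite /u; lra.
have Gu : (1 - e) * G x <= (1 + e) * G u.
  apply: (le_trans Gz); apply: (@le_trans _ _ ((1 + e) * G (z + a))).
    have /GB : B < z + a by lra.
    by rewrite addrK.
  by rewrite ler_wpM2l ?tail_antitone//; lra.
have Gx := G_gt0 x.
have E0 := Etau_ge0.
pose g := G u / G x.
have GE : G u = g * G x by rewrite /g divfK// gt_eqF.
have g1 : g <= 1 by rewrite ler_pdivrMr// mul1r.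
have g0 : 1 - 2 * e <= g.
  have : 1 - e <= (1 + e) * g.
    by rewrite -(ler_pM2r Gx) -mulrA -GE.
  by nra.
set f := 1 - M / k%:R in low.
have f0 : 1 - e <= f by rewrite /f; lra.
have f1 : f <= 1 by rewrite /f gerBl divr_ge0// ltW.
set s := S - _ in low.
have s1 : Etau - 2 * e <= s by rewrite /s; lra.
have s2 : s <= Etau by rewrite (le_trans _ SE)// /s gerBl divr_ge0 ?mulr_ge0// ltW.
have fg : 1 - f * g <= 3 * e by nra.
have fg0 : 0 <= 1 - f * g by nra.
have sfg : Etau - 2 * e - Etau * (3 * e) <= s * f * g.
  have : s * (1 - f * g) <= Etau * (3 * e).
    apply: (@le_trans _ _ (Etau * (1 - f * g))); first by rewrite ler_wpM2r.
    by rewrite ler_wpM2l.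
  by lra.
have := ler_wpM2r (ltW Gx) sfg.
rewrite GE in low.
by lra.
Unshelve. all: by end_near.
Qed.

End limits.

(** When tau vanishes almost surely h may be arbitrarily small, and the
hypotheses on h no longer give the insensitivity of the tail to constant shifts;
this case is dealt with on its own. *)
Lemma random_sum_degenerate d (T : measurableType d) (R : realType)
    (P : probability T R) (X : nat -> {RV P >-> R}) (tau : {RV P >-> nat}) :
  P [set w | (0 < tau w)%N] = 0%E ->
  ('E_P[fun w => (tau w)%:R] = 0)%E /\
  forall x, 0 <= x -> P [set w | x < random_sum X tau w] = 0%E.
Proof.
move=> tau0.
have mt i : measurable [set w | (i < tau w)%N].
  exact: (measurable_tau tau [set j | (i < j)%N]).
split=> [|x x0].
  rewrite expectation_tau eseries0// => i _ _; apply/eqP.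
  rewrite -measure_le0 -tau0 le_measure ?inE// => w /=; exact: leq_ltn_trans.
apply/eqP; rewrite -measure_le0 -tau0 le_measure ?inE//.
  exact: measurable_random_sum_gt.
move=> w /=; rewrite lt0n; apply: contraTN => /eqP t0.
by rewrite /random_sum t0 big_ord0 -leNgt.
Qed.

Theorem theorem10 (d : measure_display) (T : measurableType d) (R : realType)
  (P : probability T R)
  (xi : {RV P >-> R}) (xi_ : nat -> {RV P >-> R}) (tau : {RV P >-> nat}) :
  let Fbar := tail (distribution P xi) in
  iid_copies xi xi_ ->
  ('E_P[fun w => `|xi w|%R] < +oo)%E ->
  ('E_P[fun w => (tau w)%:R%R] < +oo)%E ->
  independent_of_future xi_ tau ->
  in_Sstar (distribution P xi) ->
  (exists h : R -> R,
    [/\ {homo h : x y / x <= y},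
        asymp_eq (fun x => Fbar (x + h x)) Fbar,
        asymp_eq (fun x => Fbar (x - h x)) Fbar
      & (fun x => fine (P [set w | h x < (tau w)%:R])) =o_ (pinfty_nbhs R) Fbar]) ->
  fine (P [set w | x < random_sum xi_ tau w]) / Fbar x
    @[x --> +oo] --> fine 'E_P[fun w => (tau w)%:R].
Proof.
move=> G iid xi_fin tau_fin indep Sstar [h [h_homo h_up h_down h_o]].
have G_gt0 x : 0 < G x by case: Sstar.
have G_anti : forall x y, x <= y -> G y <= G x by exact: tail_antitone.
have G0 : G x @[x --> +oo] --> 0 by exact: tail_cvg0.
have mgt a : measurable [set w | a < (tau w)%:R :> R].
  exact: (measurable_tau tau [set j | a < j%:R]).
have h_tau e : 0 < e -> \forall x \near +oo, fine (P [set w | h x < (tau w)%:R]) <= e * G x.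
  move=> e0; have /eqoP/(_ e e0) := h_o; apply: filterS => x.
  by rewrite ger0_norm ?fine_ge0// ger0_norm// ltW.
have [/(random_sum_degenerate xi_)[-> S0]|tau0] := eqVneq (P [set w | (0 < tau w)%N]) 0%E.
  apply: cvg_near_cst; apply: filterS (nbhs_pinfty_ge (num_real 0)) => x x0.
  by rewrite S0 ?mul0r.
have mt0 : measurable [set w | (0 < tau w)%N].
  exact: (measurable_tau tau [set j | (0 < j)%N]).
(* otherwise P(tau > h(x)) would be at least P(tau > 0) for large x *)
have h1 : \forall x \near +oo, 1 <= h x.
  have p0 : 0 < fine (P [set w | (0 < tau w)%N]).
    by rewrite fine_gt0// lt0e tau0 measure_ge0 ltey_eq fin_num_measure.
  have := h_tau 1 ltr01; have := tail_small G_gt0 G0 p0.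
  apply: filterS2 => x Gx; rewrite mul1r => hx; rewrite leNgt; apply/negP => hx1.
  have : fine (P [set w | (0 < tau w)%N]) <= fine (P [set w | h x < (tau w)%:R]).
    rewrite fine_le ?fin_num_measure// le_measure ?inE// => w /= tw.
    by rewrite (lt_le_trans hx1)// ler1n.
  by lra.
have G_long1 : asymp_eq (fun x => G (x + 1)) G.
  apply: (asymp_eq_bounds G_gt0 h_up (asymp_eq_refl G_gt0)).
  by apply: filterS h1 => x hx; rewrite !G_anti ?lerD2l ?lerDl.
have G_long c e : 0 < e -> \forall x \near +oo, G (x - c) <= (1 + e) * G x.
  exact: asymp_eq_long_tailed.
(* making h nonnegative everywhere changes nothing for large x *)
pose k x := Num.max 0 (h x).
have kE : \forall x \near +oo, k x = h x.
  by apply: filterS h1 => x hx; apply/max_idPr; rewrite (le_trans _ hx).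
have k_homo : {homo k : x y / x <= y}.
  by move=> x y xy; rewrite le_max2// h_homo.
have k_ge0 x : 0 <= k x by rewrite le_max lexx.
have k_up : asymp_eq (fun x => G (x + k x)) G.
  by apply: (asymp_eq_bounds G_gt0 h_up h_up); apply: filterS kE => x ->; rewrite lexx.
have k_down : asymp_eq (fun x => G (x - k x)) G.
  by apply: (asymp_eq_bounds G_gt0 h_down h_down); apply: filterS kE => x ->; rewrite lexx.
have k_tau e : 0 < e -> \forall x \near +oo, fine (P [set w | k x < (tau w)%:R]) <= e * G x.
  by move=> /h_tau; apply: filterS2 kE => x ->.
set E := fine _.
have E0 : 0 <= E by rewrite fine_ge0// expectation_ge0.
apply/cvgrPdist_le => eta eta0.
(* for e <= 1 both bounds differ from E by at most e * (3 + 7 * E) *)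
pose e := Num.min 1 (eta / (3 + 7 * E)).
have e0 : 0 < e by rewrite lt_min ltr01 divr_gt0//; lra.
have e1 : e <= 1 by rewrite ge_min lexx.
have eE : e * (3 + 7 * E) <= eta.
  by rewrite -ler_pdivlMr ?ge_min ?lexx ?orbT//; lra.
have eE0 : 0 <= e * E by rewrite mulr_ge0// ltW.
have ee : e * e <= e by rewrite ler_piMl// ltW.
have eeE : e * e * E <= e * E by rewrite ler_wpM2r.
have eeeE : e * e * e * E <= e * E.
  by rewrite ler_wpM2r// (le_trans _ ee)// ler_piMr// mulr_ge0 ?ltW.
have up : \forall x \near +oo, fine (P [set w | x < random_sum xi_ tau w]) <=
    (e + (1 + e) ^+ 2 * E) * (1 + e) * G x.
  exact: (random_sum_limsup iid indep G_gt0 tau_fin k_homo k_ge0 k_down k_tau G_long Sstar e0).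
have low : \forall x \near +oo, (E - e * (3 + 3 * E)) * G x <=
    fine (P [set w | x < random_sum xi_ tau w]).
  exact: (random_sum_liminf iid indep G_gt0 tau_fin xi_fin k_homo k_ge0 k_up k_tau G_long e0 e1).
move: up low; apply: filterS2 => x up low.
rewrite distrC ler_distl ler_pdivlMr// ler_pdivrMr//.
have Gx := G_gt0 x.
apply/andP; split.
  apply: le_trans low; rewrite ler_wpM2r//; first exact: ltW.
  by rewrite lerB//; lra.
apply: (le_trans up); rewrite ler_wpM2r//; first exact: ltW.
by lra.
Qed.
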